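(* Let $\bar M$ be an indefinite Kenmotsu statistical manifold and let $M$ be a contact $CR$-lightlike submanifold of $\bar M$. Then $D'$ does not define a totally geodesic foliation in $M$.
   Context: Indefinite Kenmotsu statistical manifold $(\bar M,\bar\nabla,\bar\nabla^{*},\bar g,\phi,\nu)$: $\bar M$ is a $(2n+1)$-dimensional manifold with a semi-Riemannian metric $\bar g$ of constant index $q\ge1$, a torsion-free affine connection $\bar\nabla$ with $(\bar\nabla_X\bar g)(Y,Z)=(\bar\nabla_Y\bar g)(X,Z)$, dual connection $\bar\nabla^{*}$ defined by $X\bar g(Y,Z)=\bar g(\bar\nabla_XY,Z)+\bar g(Y,\bar\nabla^{*}_XZ)$, Levi-Civita connection $\widehat{\bar\nabla}=\frac12(\bar\nabla+\bar\nabla^{*})$, and $K(X,Y)=\bar\nabla_XY-\widehat{\bar\nabla}_XY$. It carries a $(1,1)$-tensor field $\phi$, a vector field $\nu$ and a $1$-form $\eta$ with $\bar g(\phi X,\phi Y)=\bar g(X,Y)-\eta(X)\eta(Y)$, $\bar g(\nu,\nu)=1$, $\phi^2X=-X+\eta(X)\nu$, $\bar g(X,\nu)=\eta(X)$, $\bar g(\phi X,Y)+\bar g(X,\phi Y)=0$, satisfying $(\widehat{\bar\nabla}_X\phi)Y=\eta(Y)\phi X-\bar g(\phi X,Y)\nu$, $\widehat{\bar\nabla}_X\nu=-X+\eta(X)\nu$, and $K(X,\phi Y)=-\phi K(X,Y)$, for all vector fields $X,Y,Z$ on $\bar M$. Lightlike submanifold: a submanifold $M$ of $\bar M$ with degenerate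 induced metric $g$ such that $Rad(TM)=TM\cap TM^{\perp}$ is a distribution of rank $r\ge1$. $S(TM)$ (screen distribution) is a chosen complement of $Rad(TM)$ in $TM$, $TM=Rad(TM)\perp S(TM)$; $S(TM^{\perp})$ (screen transversal bundle) is a chosen complement of $Rad(TM)$ in $TM^\perp$. The lightlike transversal bundle $ltr(TM)$ is locally spanned by sections $N_i$ of the orthogonal complement of $S(TM^\perp)$ in $S(TM)^\perp$ with $\bar g(\xi_i,N_j)=\delta_{ij}$, $\bar g(N_i,N_j)=0$ for a local basis $\{\xi_i\}$ of $Rad(TM)$. Put $tr(TM)=ltr(TM)\perp S(TM^\perp)$, so $T\bar M|_M=TM\oplus tr(TM)$. For $X,Y\in\Gamma(TM)$, $\widehat\nabla_XY$ denotes the $TM$-component of $\widehat{\bar\nabla}_XY$ in this decomposition. Contact $CR$-lightlike submanifold: a lightlike submanifold $M$ tangent to $\nu$ such that (1) $Rad(TM)\cap\phi(Rad(TM))=\{0\}$, with $\phi(Rad(TM))$ a distribution on $M$; (2) there are vector bundles $D_0$, $D'$ over $M$ with $S(TM)=\{\phi(Rad(TM))\oplus D'\}\perp D_0\perp\{\nu\}$, $\phi D_0=D_0$, $\phi(D')=L_1\perp ltr(TM)$, where $D_0$ is non-degenerate and $L_1$ is a vector subbundle of $S(TM^\perp)$. Put $D=Rad(TM)\perp\phi(Rad(TM))\perp D_0$, so $TM=D\oplus D'\perp\{\nu\}$. A distribution $E$ on $M$ defines a totally geodesic foliation if $\widehat\nabla_XY\in\Gamma(E)$ for all $X,Y\i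n\Gamma(E)$.
   Formalization: L_1 is assumed to have positive rank: for L_1 = 0 the claim fails, e.g. M = R × H with H a null real hyperplane of a flat indefinite C^k in the warped product R ×_f C^k, f = e^{-t}, where D' = span(JN) is totally geodesic. *)

(* Defs.v *)
From mathcomp Require Import all_boot all_order all_algebra.
From mathcomp Require Import all_classical all_reals all_analysis.

Set Implicit Arguments.
Unset Strict Implicit.
Unset Printing Implicit Defensive.

Import Order.TTheory GRing.Theory Num.Theory.
Import numFieldNormedType.Exports.

Local Open Scope classical_set_scope.
Local Open Scope ring_scope.

(** * Smooth functions on open subsets of R^m *)

Fixpoint iter_partial (R : realType) (m : nat) (s : seq 'I_m)
    (f : 'rV[R]_m -> R) : 'rV[R]_m -> R :=
  if s is j :: s' then fun x => 'D_(delta_mx ord0 j) (iter_partial s' f) x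
  else f.

(* C^oo on an open set U: every iterated partial derivative is Frechet
   differentiable at every point of U. *)
Definition smooth_on (R : realType) (m : nat) (U : set 'rV[R]_m)
    (f : 'rV[R]_m -> R) : Prop :=
  forall (s : seq 'I_m) (x : 'rV[R]_m), U x ->
    differentiable (iter_partial s f) x.

(** * Smooth manifolds *)

(* [chart_inv] is only meaningful on [chart_image], and [chart_fun] on
   [chart_dom]. *)
Record chart (R : realType) (T : topologicalType) (m : nat) := Chart {
  chart_dom : set T;
  chart_fun : T -> 'rV[R]_m;
  chart_inv : 'rV[R]_m -> T }.

Definition chart_image (R : realType) (T : topologicalType) (m : nat)
    (c : chart R T m) : set 'rV[R]_m :=
  chart_fun c @` chart_dom c.

Record is_chart (R : realType) (T : topologicalType) (m : nat)
    (c : chart R T m) : Prop := {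
  chart_dom_open : open (chart_dom c);
  chart_image_open : open (chart_image c);
  chart_funK : forall p, chart_dom c p -> chart_inv c (chart_fun c p) = p;
  chart_fun_continuous : forall p, chart_dom c p ->
    {for p, continuous (chart_fun c)};
  chart_inv_continuous : forall x, chart_image c x ->
    {for x, continuous (chart_inv c)} }.

Record manifold (R : realType) (m : nat) := Manifold {
  mf_space :> topologicalType;
  mf_nonempty : [set: mf_space] !=set0;
  mf_hausdorff : hausdorff_space mf_space;
  mf_second_countable : @second_countable mf_space;
  mf_atlas : set (chart R mf_space m);
  mf_atlas_chart : forall c, mf_atlas c -> is_chart c;
  mf_atlas_cover : forall p : mf_space, exists2 c, mf_atlas c & chart_dom c p;
  mf_atlas_compat : forall c c', mf_atlas c -> mf_atlas c' ->
    forall j : 'I_m,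
      smooth_on (chart_fun c @` (chart_dom c `&` chart_dom c'))
        (fun x => chart_fun c' (chart_inv c x) ord0 j) }.

Definition smooth (R : realType) (m : nat) (M : manifold R m) (f : M -> R) :
    Prop :=
  forall c, mf_atlas c -> smooth_on (chart_image c) (f \o chart_inv c).

Definition smooth_map (R : realType) (m k : nat) (M : manifold R m)
    (N : manifold R k) (i : M -> N) : Prop :=
  continuous i /\
  forall (c : chart R M m) (c' : chart R N k),
    mf_atlas c -> mf_atlas c' -> forall j : 'I_k,
      smooth_on (chart_fun c @` (chart_dom c `&` i @^-1` chart_dom c'))
        (fun x => chart_fun c' (i (chart_inv c x)) ord0 j).

(** * Tangent vectors, vector fields, connections *)

(* Tangent vectors of [M] are point derivations of C^oo(M).  They all live in
   the ambient vector space of functionals on [M -> R], so that subspaces of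
   tangent spaces are plain sets. *)
Notation functional M R := ((M -> R) -> R).

(* A tangent vector takes the junk value 0 outside C^oo(M), so that equality
   of functionals is equality of derivations of C^oo(M). *)
Record tangent (R : realType) (m : nat) (M : manifold R m) (p : M)
    (v : functional M R) : Prop := {
  tangent_linear : forall (a : R) (f h : M -> R), smooth f -> smooth h ->
    v (fun q => a * f q + h q) = a * v f + v h;
  tangent_leibniz : forall f h : M -> R, smooth f -> smooth h ->
    v (fun q => f q * h q) = f p * v h + h p * v f;
  tangent_junk : forall f : M -> R, ~ smooth f -> v f = 0 }.

Definition vfield (R : realType) (m : nat) (M : manifold R m)
    (X : M -> functional M R) : Prop :=
  (forall p, tangent p (X p)) /\
  (forall f : M -> R, smooth f -> smooth (fun p => X p f)).

Definition lie_bracket (R : realType) (m : nat) (M : manifold R m)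
    (X Y : M -> functional M R) : M -> functional M R :=
  fun p f => X p (fun q => Y q f) - Y p (fun q => X q f).

Record affine_connection (R : realType) (m : nat) (M : manifold R m)
    (nabla : (M -> functional M R) -> (M -> functional M R) ->
             (M -> functional M R)) : Prop := {
  connection_vfield : forall X Y, vfield X -> vfield Y -> vfield (nabla X Y);
  connectionDl : forall X X' Y, vfield X -> vfield X' -> vfield Y ->
    forall p, nabla (fun q => X q + X' q) Y p = nabla X Y p + nabla X' Y p;
  connectionZl : forall (f : M -> R) X Y, smooth f -> vfield X -> vfield Y ->
    forall p, nabla (fun q => f q *: X q) Y p = f p *: nabla X Y p;
  connectionDr : forall X Y Y', vfield X -> vfield Y -> vfield Y' ->
    forall p, nabla X (fun q => Y q + Y' q) p = nabla X Y p + nabla X Y' p;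
  connection_leibniz : forall (f : M -> R) X Y,
    smooth f -> vfield X -> vfield Y ->
    forall p,
      nabla X (fun q => f q *: Y q) p = X p f *: Y p + f p *: nabla X Y p }.

Definition torsion_free (R : realType) (m : nat) (M : manifold R m)
    (nabla : (M -> functional M R) -> (M -> functional M R) ->
             (M -> functional M R)) : Prop :=
  forall X Y, vfield X -> vfield Y ->
    forall p, nabla X Y p - nabla Y X p = lie_bracket X Y p.

(** * Semi-Riemannian metrics *)

Definition negative_definite_family (R : realType) (m : nat)
    (M : manifold R m) (g : M -> functional M R -> functional M R -> R)
    (p : M) (k : nat) : Prop :=
  exists e : 'I_k -> functional M R,
    (forall j, tangent p (e j)) /\
    forall c : 'I_k -> R, (exists j, c j != 0) ->
      g p (\sum_j c j *: e j) (\sum_j c j *: e j) < 0.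

(* The index is the largest dimension of a subspace of the tangent space on
   which the metric is negative definite. *)
Record semi_riemannian (R : realType) (m : nat) (M : manifold R m) (q : nat)
    (g : M -> functional M R -> functional M R -> R) : Prop := {
  metric_sym : forall p u v, tangent p u -> tangent p v -> g p u v = g p v u;
  metric_linear : forall p (a : R) u v w,
    tangent p u -> tangent p v -> tangent p w ->
    g p (a *: u + v) w = a * g p u w + g p v w;
  metric_nondegenerate : forall p u, tangent p u ->
    (forall v, tangent p v -> g p u v = 0) -> u = 0;
  metric_smooth : forall X Y, vfield X -> vfield Y ->
    smooth (fun p => g p (X p) (Y p));
  metric_index : forall p,
    negative_definite_family g p q /\ ~ negative_definite_family g p q.+1 }.

(** * Indefinite Kenmotsu statistical manifolds *)

Record kenmotsu_statistical (R : realType) (n q : nat)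
    (Mb : manifold R (2 * n + 1)) := KenmotsuStatistical {
  ks_g : Mb -> functional Mb R -> functional Mb R -> R;
  ks_nabla : (Mb -> functional Mb R) -> (Mb -> functional Mb R) ->
             (Mb -> functional Mb R);
  ks_dual : (Mb -> functional Mb R) -> (Mb -> functional Mb R) ->
            (Mb -> functional Mb R);
  ks_phi : Mb -> functional Mb R -> functional Mb R;
  ks_nu : Mb -> functional Mb R;
  ks_eta : Mb -> functional Mb R -> R;
  (* the averaged connection, and the difference tensor K *)
  ks_lc := fun X Y (p : Mb) => 2%:R^-1 *: (ks_nabla X Y p + ks_dual X Y p);
  ks_K := fun X Y (p : Mb) => ks_nabla X Y p - ks_lc X Y p;

  ks_index : (1 <= q)%N;
  ks_metric : semi_riemannian q ks_g;
  ks_connection : affine_connection ks_nabla;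
  ks_torsion_free : torsion_free ks_nabla;
  ks_codazzi : forall X Y Z, vfield X -> vfield Y -> vfield Z -> forall p,
    X p (fun x => ks_g x (Y x) (Z x))
      - ks_g p (ks_nabla X Y p) (Z p) - ks_g p (Y p) (ks_nabla X Z p)
    = Y p (fun x => ks_g x (X x) (Z x))
      - ks_g p (ks_nabla Y X p) (Z p) - ks_g p (X p) (ks_nabla Y Z p);
  ks_dual_connection : affine_connection ks_dual;
  ks_duality : forall X Y Z, vfield X -> vfield Y -> vfield Z -> forall p,
    X p (fun x => ks_g x (Y x) (Z x))
    = ks_g p (ks_nabla X Y p) (Z p) + ks_g p (Y p) (ks_dual X Z p);

  ks_phi_tangent : forall p u, tangent p u -> tangent p (ks_phi p u);
  ks_phi_linear : forall p (a : R) u v, tangent p u -> tangent p v ->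
    ks_phi p (a *: u + v) = a *: ks_phi p u + ks_phi p v;
  ks_phi_smooth : forall X, vfield X -> vfield (fun p => ks_phi p (X p));
  ks_nu_vfield : vfield ks_nu;
  ks_eta_linear : forall p (a : R) u v, tangent p u -> tangent p v ->
    ks_eta p (a *: u + v) = a * ks_eta p u + ks_eta p v;
  ks_eta_smooth : forall X, vfield X -> smooth (fun p => ks_eta p (X p));

  ks_g_phi_phi : forall X Y, vfield X -> vfield Y -> forall p,
    ks_g p (ks_phi p (X p)) (ks_phi p (Y p))
    = ks_g p (X p) (Y p) - ks_eta p (X p) * ks_eta p (Y p);
  ks_g_nu_nu : forall p, ks_g p (ks_nu p) (ks_nu p) = 1;
  ks_phi_phi : forall X, vfield X -> forall p,
    ks_phi p (ks_phi p (X p)) = - X p + ks_eta p (X p) *: ks_nu p;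
  ks_g_nu : forall X, vfield X -> forall p,
    ks_g p (X p) (ks_nu p) = ks_eta p (X p);
  ks_phi_skew : forall X Y, vfield X -> vfield Y -> forall p,
    ks_g p (ks_phi p (X p)) (Y p) + ks_g p (X p) (ks_phi p (Y p)) = 0;
  ks_lc_phi : forall X Y, vfield X -> vfield Y -> forall p,
    ks_lc X (fun x => ks_phi x (Y x)) p - ks_phi p (ks_lc X Y p)
    = ks_eta p (Y p) *: ks_phi p (X p)
      - ks_g p (ks_phi p (X p)) (Y p) *: ks_nu p;
  ks_lc_nu : forall X, vfield X -> forall p,
    ks_lc X ks_nu p = - X p + ks_eta p (X p) *: ks_nu p;
  ks_K_phi : forall X Y, vfield X -> vfield Y -> forall p,
    ks_K X (fun x => ks_phi x (Y x)) p = - ks_phi p (ks_K X Y p) }.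

(** * Subspaces *)

Definition is_basis (R : realType) (V : lmodType R) (k : nat) (E : set V)
    (e : 'I_k -> V) : Prop :=
  E = [set v | exists c : 'I_k -> R, v = \sum_j c j *: e j] /\
  forall c : 'I_k -> R, \sum_j c j *: e j = 0 -> forall j, c j = 0.

Definition set_sum (R : realType) (V : lmodType R) (A B : set V) : set V :=
  [set a + b | a in A & b in B].

Definition direct_sum (R : realType) (V : lmodType R) (E A B : set V) : Prop :=
  E = set_sum A B /\ A `&` B = [set 0].

Definition orthogonal (R : realType) (V : lmodType R) (b : V -> V -> R)
    (A B : set V) : Prop :=
  forall u v, A u -> B v -> b u v = 0.

Definition orthogonal_sum (R : realType) (V : lmodType R) (b : V -> V -> R)
    (E A B : set V) : Prop :=
  direct_sum E A B /\ orthogonal b A B.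

(** * Immersed submanifolds and bundles along them *)

Definition differential (R : realType) (m k : nat) (M : manifold R m)
    (N : manifold R k) (i : M -> N) (u : functional M R) : functional N R :=
  fun f => if `[< smooth f >] then u (f \o i) else 0.

Definition immersed_submanifold (R : realType) (m k : nat) (M : manifold R m)
    (N : manifold R k) (i : M -> N) : Prop :=
  [/\ smooth_map i,
      injective i &
      forall (p : M) (u u' : functional M R), tangent p u -> tangent p u' ->
        differential i u = differential i u' -> u = u'].

Definition TM (R : realType) (m k : nat) (M : manifold R m)
    (N : manifold R k) (i : M -> N) (p : M) : set (functional N R) :=
  differential i @` tangent p.

(* A rank-k vector subbundle of the restriction to [M] of the tangent bundle
   of [N]; "near p" refers to the topology of [M]. *)
Definition subbundle (R : realType) (m k : nat) (M : manifold R m)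
    (N : manifold R k) (i : M -> N) (r : nat)
    (E : M -> set (functional N R)) : Prop :=
  forall p : M, exists Z : 'I_r -> N -> functional N R,
    (forall j, vfield (Z j)) /\
    \forall q \near p, is_basis (E q) (fun j => Z j (i q)).

(* [Z] extends the field [X] along [M] near [p]. *)
Definition extends_near (R : realType) (m k : nat) (M : manifold R m)
    (N : manifold R k) (i : M -> N) (X : M -> functional N R) (p : M)
    (Z : N -> functional N R) : Prop :=
  vfield Z /\ \forall q \near p, X q = Z (i q).

(* Global smooth sections of [E]; a field along [M] is smooth iff it extends
   locally to a smooth vector field of the ambient manifold. *)
Definition section_of (R : realType) (m k : nat) (M : manifold R m)
    (N : manifold R k) (i : M -> N) (E : M -> set (functional N R))
    (X : M -> functional N R) : Prop :=
  (forall p, E p (X p)) /\ forall p, exists Z, extends_near i X p Z.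

(** * Lightlike submanifolds *)

Definition TMperp (R : realType) (n q m : nat) (Mb : manifold R (2 * n + 1))
    (S : kenmotsu_statistical q Mb) (M : manifold R m) (i : M -> Mb) (p : M) :
    set (functional Mb R) :=
  [set v | tangent (i p) v /\ forall u, TM i p u -> ks_g S (i p) v u = 0].

Definition Rad (R : realType) (n q m : nat) (Mb : manifold R (2 * n + 1))
    (S : kenmotsu_statistical q Mb) (M : manifold R m) (i : M -> Mb) (p : M) :
    set (functional Mb R) :=
  TM i p `&` TMperp S i p.

Definition lightlike_transversal (R : realType) (n q m : nat)
    (Mb : manifold R (2 * n + 1)) (S : kenmotsu_statistical q Mb)
    (M : manifold R m) (i : M -> Mb) (r : nat)
    (STM STperp ltr : M -> set (functional Mb R)) : Prop :=
  forall p : M, exists xi N : 'I_r -> Mb -> functional Mb R,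
    (forall j, vfield (xi j) /\ vfield (N j)) /\
    \forall x \near p,
      [/\ is_basis (Rad S i x) (fun j => xi j (i x)),
          is_basis (ltr x) (fun j => N j (i x)),
          forall j u, STM x u \/ STperp x u -> ks_g S (i x) (N j (i x)) u = 0,
          forall j l, ks_g S (i x) (xi j (i x)) (N l (i x)) = (j == l)%:R &
          forall j l, ks_g S (i x) (N j (i x)) (N l (i x)) = 0].

Record lightlike_submanifold (R : realType) (n q m : nat)
    (Mb : manifold R (2 * n + 1)) (S : kenmotsu_statistical q Mb)
    (M : manifold R m) (i : M -> Mb) (r : nat)
    (STM STperp ltr : M -> set (functional Mb R)) : Prop := {
  ll_immersed : immersed_submanifold i;
  ll_rank : (1 <= r)%N;
  ll_rad : subbundle i r (Rad S i);
  ll_screen_bundle : exists k, subbundle i k STM;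
  ll_screen : forall p,
    orthogonal_sum (ks_g S (i p)) (TM i p) (Rad S i p) (STM p);
  ll_transversal_bundle : exists k, subbundle i k STperp;
  ll_transversal : forall p,
    orthogonal_sum (ks_g S (i p)) (TMperp S i p) (Rad S i p) (STperp p);
  ll_ltr : lightlike_transversal S i r STM STperp ltr }.

Definition phi_Rad (R : realType) (n q m : nat) (Mb : manifold R (2 * n + 1))
    (S : kenmotsu_statistical q Mb) (M : manifold R m) (i : M -> Mb) (p : M) :
    set (functional Mb R) :=
  ks_phi S (i p) @` Rad S i p.

(* [ccr_L1_bundle] takes L1 to be of positive rank: if L1 = 0 then
   D' = phi(ltr(TM)) is totally null and may well be totally geodesic, e.g.
   for M = R x H with H a null real hyperplane of an indefinite C^n, in the
   warped product R x_f C^n with f(t) = exp(-t) and nu = d/dt. *)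
Record contact_CR_lightlike (R : realType) (n q m : nat)
    (Mb : manifold R (2 * n + 1)) (S : kenmotsu_statistical q Mb)
    (M : manifold R m) (i : M -> Mb) (r : nat)
    (STM STperp ltr D0 D' L1 : M -> set (functional Mb R)) : Prop := {
  ccr_lightlike : lightlike_submanifold S i r STM STperp ltr;
  ccr_nu : forall p, TM i p (ks_nu S (i p));
  ccr_phi_Rad_trivial : forall p, Rad S i p `&` phi_Rad S i p = [set 0];
  ccr_phi_Rad_tangent : forall p, phi_Rad S i p `<=` TM i p;
  ccr_phi_Rad_bundle : exists k, subbundle i k (phi_Rad S i);
  ccr_D0_bundle : exists k, subbundle i k D0;
  ccr_D'_bundle : exists k, subbundle i k D';
  ccr_screen : forall p,
    let g := ks_g S (i p) in
    let nu_line := [set a *: ks_nu S (i p) | a in [set: R]] in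
    exists E F : set (functional Mb R),
      [/\ direct_sum E (phi_Rad S i p) (D' p),
          orthogonal_sum g F E (D0 p) &
          orthogonal_sum g (STM p) F nu_line];
  ccr_phi_D0 : forall p, ks_phi S (i p) @` D0 p = D0 p;
  ccr_phi_D' : forall p,
    orthogonal_sum (ks_g S (i p)) (ks_phi S (i p) @` D' p) (L1 p) (ltr p);
  ccr_D0_nondegenerate : forall p u, D0 p u ->
    (forall v, D0 p v -> ks_g S (i p) u v = 0) -> u = 0;
  ccr_L1_bundle : exists2 k, (1 <= k)%N & subbundle i k L1;
  ccr_L1_sub : forall p, L1 p `<=` STperp p }.

(** * Totally geodesic foliations *)

(* [v] is the value at [p] of the ambient Levi-Civita derivative of [Y] in the
   direction [X], for fields [X], [Y] along [M] with [X] tangent to [M]; it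
   does not depend on the local extensions. *)
Definition lc_along (R : realType) (n q m : nat) (Mb : manifold R (2 * n + 1))
    (S : kenmotsu_statistical q Mb) (M : manifold R m) (i : M -> Mb)
    (X Y : M -> functional Mb R) (p : M) (v : functional Mb R) : Prop :=
  exists X' Y', [/\ extends_near i X p X', extends_near i Y p Y' &
                    v = ks_lc S X' Y' (i p)].

(* [Z] is the TM-component of the above derivative in the decomposition of the
   restricted tangent bundle as TM + tr(TM); this determines [Z]. *)
Definition induced_derivative (R : realType) (n q m : nat)
    (Mb : manifold R (2 * n + 1)) (S : kenmotsu_statistical q Mb)
    (M : manifold R m) (i : M -> Mb)
    (STperp ltr : M -> set (functional Mb R))
    (X Y Z : M -> functional Mb R) : Prop :=
  forall p, TM i p (Z p) /\
    exists2 w, set_sum (ltr p) (STperp p) w & lc_along S i X Y p (Z p + w).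

Definition totally_geodesic_foliation (R : realType) (n q m : nat)
    (Mb : manifold R (2 * n + 1)) (S : kenmotsu_statistical q Mb)
    (M : manifold R m) (i : M -> Mb)
    (STperp ltr E : M -> set (functional Mb R)) : Prop :=
  forall X Y, section_of i E X -> section_of i E Y ->
    exists2 Z, induced_derivative S i STperp ltr X Y Z & section_of i E Z.

(* Main.v *)
Require Import Defs.
From mathcomp Require Import all_boot all_order all_algebra.
From mathcomp Require Import all_classical all_reals all_analysis.
From mathcomp Require Import ring lra.

(** The characteristic field nu forces the answer.  Since the Levi-Civita
derivative of nu along X is - X + eta(X) nu, and since D' is orthogonal to nu,
metric compatibility gives g(lc_X Y, nu) = g(X, Y) for sections X, Y of D'
([levi_civita_nu], [induced_derivative_nu]).  The transversal part of lc_X Y is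
orthogonal to nu, which lies in the screen, so the same holds for the
TM-component of lc_X Y.  If that component lies in D', which is orthogonal to
nu, then g(X, Y) = 0: a totally geodesic D' is totally null.

But D' is nowhere totally null ([D'_not_null]).  Choose l <> 0 in L1 and u in D'
with phi u = l.  The only summand of TM that could pair nontrivially with u,
besides D' itself, is phi(Rad), and g(u, phi sigma) = - g(l, sigma) = 0 because
l is normal to M.  If D' were null, u would therefore lie in Rad, hence in
the intersection of Rad with the screen, which is zero, contradicting
phi u = l <> 0.

What remains is to pass between vectors and global sections.  A vector of a
bundle along M is the value of a global section ([subbundle_section]): a local
frame combination is multiplied by a cut-off function on M that still extends
locally to the ambient manifold, although i is only an injective immersion and
M need not carry the induced topology.  Derivations of C^oo(M) are local
([tangent_near0]), so X(g(Y, nu)) vanishes when g(Y, nu) does along M.  Both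
rest on smooth bump functions ([bump]), built in a chart from the flat function
exp(-1/t). *)

Set Implicit Arguments.
Unset Strict Implicit.
Unset Printing Implicit Defensive.

Import Order.TTheory GRing.Theory Num.Theory.
Import numFieldNormedType.Exports.

Local Open Scope classical_set_scope.
Local Open Scope ring_scope.

(** * Smooth functions on open subsets of R^m *)

(** Only the germ matters: g - f vanishes near x, so it is differentiable with
zero differential. *)
Lemma near_eq_differentiable (R : numFieldType) (V W : normedModType R)
    (f g : V -> W) (x : V) :
  (\near x, f x = g x) -> differentiable f x -> differentiable g x.
Proof.
move=> fg df; pose u := g - f.
have u0 : u \o shift x = cst (u x) + (0 : V -> W) +o_ 0 id.
  apply/eqaddoP => e e0.
  have : \forall h \near (0 : V), f (h + x) = g (h + x).
    by move: fg; rewrite (near_shift 0) subr0.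
  apply: filterS => h fgh.
  have ux : u x = 0 by rewrite /u !fctE (nbhs_singleton fg) subrr.
  rewrite !fctE /= ux add0r.
  have -> : u (h + x) - (0 : V -> W) h = 0 by rewrite /u !fctE fgh addrN subr0.
  by rewrite normr0 mulr_ge0 // ltW.
have du : 'd u x = (0 : V -> W) :> (_ -> _).
  by apply: diff_unique => //; exact: cst_continuous.
rewrite -(subrK f g) addrC; apply: differentiableD => //.
by apply/diff_locallyP; rewrite du; split => //; exact: cst_continuous.
Qed.

Section FlatFunction.
Variable R : realType.
Implicit Type p : {poly R}.

(** The functions P(1/t) exp(-1/t), extended by 0: a class containing exp(-1/t)
and closed under differentiation, the derivative having the polynomial
X^2 (P - P'). *)
Definition flat p (t : R) : R :=
  if 0 < t then p.[t^-1] * expR (- t^-1) else 0.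

Definition flat_deriv p : {poly R} := 'X^2 * (p - p^`()).

Lemma horner_bound p : exists2 C : R, 0 <= C &
  forall u, 1 <= u -> `|p.[u]| <= C * u ^+ size p.
Proof.
exists (\sum_(i < size p) `|p`_i|); first by apply: sumr_ge0.
move=> u u1; rewrite horner_coef (le_trans (ler_norm_sum _ _ _)) //.
rewrite mulr_suml; apply: ler_sum => i _.
have u0 : 0 <= u by rewrite (le_trans _ u1).
rewrite normrM normrX (ger0_norm u0) ler_wpM2l //.
by apply: ler_weXn2l => //; exact: ltnW.
Qed.

(** Near 0 a polynomial in 1/t is beaten by exp(-1/t), since
exp u >= u ^ N / N! for every N; N = size p + 2 leaves a factor t ^ 2. *)
Lemma flat_bound p : exists2 C : R, 0 <= C &
  forall t, `|t| <= 1 -> `|flat p t| <= C * t ^+ 2.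
Proof.
have [C C0 HC] := horner_bound p; set N := (size p).+2.
exists (C * N`!%:R); first by rewrite mulr_ge0.
move=> t t1; rewrite /flat; case: ifPn => [t0|_]; last first.
  by rewrite normr0 mulr_ge0 ?sqr_ge0 // mulr_ge0.
have u1 : 1 <= t^-1.
  by rewrite invf_ge1 // (le_trans _ t1) // ler_norm.
rewrite -{3}[t]invrK; move: (t^-1) u1 => {t t1 t0} u u1.
have u0 : 0 < u by rewrite (lt_le_trans _ u1).
have NE : u ^+ N / N`!%:R <= expR u.
  by apply: le_trans (expR_ge1Dxn (size p).+1 (ltW u0)); rewrite lerDr.
rewrite normrM (ger0_norm (expR_ge0 _)) expRN.
have fN : (0 : R) < N`!%:R by rewrite ltr0n fact_gt0.
have eN : (expR u)^-1 <= N`!%:R / u ^+ N.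
  rewrite -[leRHS]invrK lef_pV2 ?posrE ?expR_gt0 ?invr_gt0 ?divr_gt0 ?exprn_gt0//.
  by rewrite invf_div.
apply: le_trans (ler_pM _ _ (HC u u1) eN) _; rewrite ?invr_ge0 ?expR_ge0 //.
rewrite {2}/N !exprSr; have : u ^+ size p != 0 by rewrite expf_neq0 ?gt_eqF.
move: (u ^+ size p) N`!%:R => a b a0; rewrite le_eqVlt; apply/orP; left.
by apply/eqP; field; rewrite a0 gt_eqF.
Qed.

Lemma is_derive_quadratic_bound (f : R -> R) (C : R) :
  (forall t, `|t| <= 1 -> `|f t| <= C * t ^+ 2) ->
  is_derive (0 : R) (1 : R) f (0 : R).
Proof.
move=> fC; have f0 : f 0 = 0.
  apply/eqP; rewrite -normr_le0 (le_trans (fC 0 _)) ?normr0 //.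
  by rewrite expr0n mulr0.
have lim0 : h^-1 *: (f (h *: 1 + 0) - f 0) @[h --> 0^'] --> (0 : R).
  apply/cvgr0Pnorm_lt => e e0; rewrite near_withinE.
  have C0 : 0 <= C.
    have := fC 1; rewrite normr1 expr1n mulr1 lexx => /(_ isT).
    exact: le_trans.
  have d0 : 0 < Num.min 1 (e / (C + 1)).
    by rewrite lt_min ltr01 divr_gt0 // ltr_wpDl.
  exists (Num.min 1 (e / (C + 1))) => //= h.
  rewrite /ball_ /= sub0r normrN lt_min => /andP[h1 he] hn0.
  rewrite f0 subr0 addr0 [h *: 1]mulr1 normrZ normfV.
  rewrite mulrC ltr_pdivrMr ?normr_gt0 //.
  rewrite (le_lt_trans (fC _ (ltW h1))) // -[h ^+ 2]real_normK ?num_real //.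
  rewrite expr2 mulrA ltr_pM2r ?normr_gt0 //.
  move: he; rewrite ltr_pdivlMr ?ltr_wpDl //; apply: le_lt_trans.
  by rewrite mulrC ler_wpM2l // lerDl.
apply: DeriveDef.
  by apply/cvg_ex; exists 0.
exact: cvg_lim lim0.
Qed.

Lemma is_derive_flat p t :
  is_derive (t : R) (1 : R) (flat p) (flat (flat_deriv p) t).
Proof.
have [t0|t0|->] := ltgtP t 0; last first.
- rewrite /flat ltxx; have [C _ HC] := flat_bound p.
  exact: is_derive_quadratic_bound HC.
- have tn0 : t != 0 by rewrite gt_eqF.
  have dV : is_derive (t : R) (1 : R) (fun s : R => s^-1) (- t ^- 2).
    by apply: is_derive_eq (is_deriveV tn0 _) _; rewrite [_ *: _]mulr1.
  have dN : is_derive (t : R) (1 : R) (fun s : R => - s^-1) (t ^- 2).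
    by apply: is_derive_eq (is_deriveN dV) _; rewrite opprK.
  have dp := @is_derive1_comp _ (horner p) (fun s => s^-1) _ _ _
    (is_derive_poly p t^-1) dV.
  have de := @is_derive1_comp _ expR (fun s => - s^-1) _ _ _
    (is_derive_expR (- t^-1)) dN.
  have dM := is_deriveM dp de.
  apply: (@near_eq_is_derive _ _ _
      ((horner p \o (fun s => s^-1)) * (expR \o (fun s => - s^-1)))).
    near=> s; have s0 : 0 < s by near: s; exact: lt_nbhsr.
    by rewrite /flat s0.
  apply: is_derive_eq dM _ => /=.
  rewrite /flat t0 /flat_deriv hornerM hornerXn hornerD hornerN exprVn.
  by rewrite [_ *: (_ / _)]mulrC [_ *: (_ * - _)]mulrC; ring.

- rewrite {2}/flat ltNge (ltW t0) /=.
  apply: (@near_eq_is_derive _ _ _ (cst 0)).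
    by near=> s; rewrite /flat ltNge ltW //=; near: s; exact: lt_nbhsl.
Unshelve. all: by end_near. Qed.

End FlatFunction.

Section SmoothOnCalculus.
Variables (R : realType) (m : nat).
Implicit Types (f g : 'rV[R]_m -> R) (U : set 'rV[R]_m) (k : nat).

Lemma iter_partial_eq_on U f g s : open U -> (forall x, U x -> f x = g x) ->
  forall x, U x -> iter_partial s f x = iter_partial s g x.
Proof.
move=> oU fg; elim: s => //= j s IH x xU; apply: near_eq_derive.
by apply: filterS (open_nbhs_nbhs (conj oU xU)).
Qed.

(** The last index of the list is the derivative taken first; this is what makes
induction on the order of differentiability possible. *)
Lemma iter_partial_rcons s j f :
  iter_partial (rcons s j) f = iter_partial s ('D_(delta_mx ord0 j) f).
Proof. by elim: s => //= k s ->. Qed.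

(** Finite order is what makes induction available: closure of [smooth_on] under
products and composition is proved by induction on k, because the product and
chain rules express one derivative of the result through functions of class one
order lower. *)
Definition Ck_on k U f : Prop :=
  forall s : seq 'I_m, (size s <= k)%N ->
  forall x, U x -> differentiable (iter_partial s f) x.

Lemma smooth_onP U f : smooth_on U f <-> forall k, Ck_on k U f.
Proof.
by split=> [sf k s _|sf s]; [exact: sf|exact: (sf (size s) s)].
Qed.

Lemma Ck_on_eq k U f g : open U -> (forall x, U x -> f x = g x) ->
  Ck_on k U f -> Ck_on k U g.
Proof.
move=> oU fg sf s sk x xU; apply: near_eq_differentiable (sf s sk x xU).
apply: filterS (open_nbhs_nbhs (conj oU xU)).
exact: iter_partial_eq_on.
Qed.

Lemma Ck_onS k U f : Ck_on k.+1 U f <->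
  (forall x, U x -> differentiable f x) /\
  forall j, Ck_on k U ('D_(delta_mx ord0 j) f).
Proof.
split=> [sf|[df sf]].
  split=> [x|j s sk]; first exact: (sf [::]).
  by rewrite -iter_partial_rcons; apply: sf; rewrite size_rcons.
move=> s; case: (lastP s) => [_|s' j]; first exact: df.
by rewrite size_rcons ltnS iter_partial_rcons; exact: sf.
Qed.

Lemma Ck_on_pred k U f : Ck_on k.+1 U f -> Ck_on k U f.
Proof. by move=> sf s sk; apply: sf; exact: leqW. Qed.

Lemma Ck_on_cst k U (a : R) : Ck_on k U (cst a).
Proof.
elim: k a => [|k IH] a; first by case=> // _ x _; exact: differentiable_cst.
apply/Ck_onS; split=> [x _|j]; first exact: differentiable_cst.
by rewrite (_ : 'D__ _ = cst 0) //; apply/funext => x; rewrite derive_cst.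
Qed.

Lemma Ck_onD k U f g : open U -> Ck_on k U f -> Ck_on k U g ->
  Ck_on k U (f + g).
Proof.
move=> oU; elim: k f g => [|k IH] f g sf sg.
  case=> // _ x xU.
  by apply: differentiableD; [exact: sf [::] _ x xU|exact: sg [::] _ x xU].
have [df Df] := iffLR (Ck_onS _ _ _) sf; have [dg Dg] := iffLR (Ck_onS _ _ _) sg.
apply/Ck_onS; split=> [x xU|j].
  by apply: differentiableD; [exact: df|exact: dg].
apply: Ck_on_eq (IH _ _ (Df j) (Dg j)) => // x xU.
by rewrite deriveD //; apply: diff_derivable; [exact: df|exact: dg].
Qed.

Lemma Ck_onM k U f g : open U -> Ck_on k U f -> Ck_on k U g ->
  Ck_on k U (f * g).
Proof.
move=> oU; elim: k f g => [|k IH] f g sf sg.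
  case=> // _ x xU.
  by apply: differentiableM; [exact: sf [::] _ x xU|exact: sg [::] _ x xU].
have [df Df] := iffLR (Ck_onS _ _ _) sf; have [dg Dg] := iffLR (Ck_onS _ _ _) sg.
apply/Ck_onS; split=> [x xU|j].
  by apply: differentiableM; [exact: df|exact: dg].
have sDM := Ck_onD oU (IH _ _ (Ck_on_pred sf) (Dg j))
                      (IH _ _ (Ck_on_pred sg) (Df j)).
apply: Ck_on_eq sDM => // x xU.
by rewrite deriveM //; apply: diff_derivable; [exact: df|exact: dg].
Qed.

Lemma derive_comp_scalar f (phi : R -> R) (d : R) (x v : 'rV[R]_m) :
  differentiable f x -> is_derive (f x) (1 : R) phi d ->
  differentiable (phi \o f) x /\ 'D_v (phi \o f) x = d * 'D_v f x.
Proof.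
move=> df [dphi <-]; have dphi' := iffLR (derivable1_diffP _ _) dphi.
have dc := differentiable_comp df dphi'.
split=> //; rewrite !deriveE // diff_comp //= diff1E // derive1E mulrC.
by rewrite scale1r.
Qed.

(** The functions phi range over a class closed under differentiation, so that the
derivative psi of phi falls under the induction hypothesis. *)
Lemma Ck_on_comp (F : set (R -> R)) k U f phi :
  (forall phi, F phi ->
    exists2 psi, F psi & forall t : R, is_derive t (1 : R) phi (psi t)) ->
  open U -> Ck_on k U f -> F phi -> Ck_on k U (phi \o f).
Proof.
move=> FD oU; elim: k f phi => [|k IH] f phi sf Fphi.
  have [psi _ dphi] := FD _ Fphi; case=> // _ x xU.
  by apply: (derive_comp_scalar 0 _ (dphi _)).1; exact: sf [::] _ x xU.
have [psi Fpsi dphi] := FD _ Fphi; have [df Df] := iffLR (Ck_onS _ _ _) sf.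
apply/Ck_onS; split=> [x xU|j].
  by apply: (derive_comp_scalar 0 _ (dphi _)).1; exact: df.
apply: Ck_on_eq (Ck_onM oU (IH _ _ (Ck_on_pred sf) Fpsi) (Df j)) => // x xU.
by rewrite (derive_comp_scalar _ (df x xU) (dphi _)).2.
Qed.

Lemma smooth_on_local U f :
  (forall x, U x -> exists V g, [/\ open V, V x, smooth_on V g &
     forall y, V y -> f y = g y]) -> smooth_on U f.
Proof.
move=> fU s x xU; have [V [g [oV xV sg fg]]] := fU x xU.
apply: near_eq_differentiable (sg s x xV).
apply: filterS (open_nbhs_nbhs (conj oV xV)) => y yV.
by rewrite (iter_partial_eq_on _ oV fg).
Qed.

Lemma smooth_on_cst U (a : R) : smooth_on U (cst a).
Proof. by apply/smooth_onP => k; exact: Ck_on_cst. Qed.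

Lemma smooth_onD U f g : open U -> smooth_on U f -> smooth_on U g ->
  smooth_on U (f + g).
Proof.
by move=> oU /smooth_onP sf /smooth_onP sg; apply/smooth_onP => k; exact: Ck_onD.
Qed.

Lemma smooth_onM U f g : open U -> smooth_on U f -> smooth_on U g ->
  smooth_on U (f * g).
Proof.
by move=> oU /smooth_onP sf /smooth_onP sg; apply/smooth_onP => k; exact: Ck_onM.
Qed.

Lemma smooth_on_sum U (I : Type) (s : seq I) (F : I -> 'rV[R]_m -> R) : open U ->
  (forall j, smooth_on U (F j)) -> smooth_on U (fun x => \sum_(j <- s) F j x).
Proof.
move=> oU sF; elim: s => [|j s IH].
  rewrite (_ : (fun _ => _) = cst 0); first exact: smooth_on_cst.
  by apply/funext => x; rewrite big_nil.
rewrite (_ : (fun _ => _) = F j + (fun x => \sum_(j <- s) F j x)).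
  exact: smooth_onD.
by apply/funext => x; rewrite big_cons.
Qed.

Lemma smooth_on_flat U f p : open U -> smooth_on U f ->
  smooth_on U (flat p \o f).
Proof.
move=> oU /smooth_onP sf; apply/smooth_onP => k.
have FD : forall phi : R -> R, range (@flat R) phi -> exists2 psi,
    range (@flat R) psi & forall t : R, is_derive t (1 : R) phi (psi t).
 
move=> _ [q _ <-]; exists (flat (flat_deriv q)); last exact: is_derive_flat.
  by exists (flat_deriv q).
by apply: (Ck_on_comp FD) => //; exists p.
Qed.

End SmoothOnCalculus.

(** * Compact neighbourhoods and bump functions *)

Section Bumps.
Variables (R : realType) (m : nat).
Implicit Types (M : manifold R m).

Lemma chart_invP (T : topologicalType) (c : chart R T m) x : is_chart c ->
  chart_image c x ->
  chart_dom c (chart_inv c x) /\ chart_fun c (chart_inv c x) = x.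
Proof. by move=> cc [q qc <-]; rewrite (chart_funK cc). Qed.

Lemma chart_image_setI (T : topologicalType) (c : chart R T m) (O : set T) :
  is_chart c ->
  chart_fun c @` (chart_dom c `&` O) = chart_image c `&` chart_inv c @^-1` O.
Proof.
move=> cc; apply/seteqP; split=> [_ [q [qc qO] <-]|x [xi xO]].
  by split; [exists q|rewrite /= (chart_funK cc)].
by have [xd <-] := chart_invP cc xi; exists (chart_inv c x).
Qed.

Lemma chart_image_open_setI (T : topologicalType) (c : chart R T m)
    (O : set T) : is_chart c -> open O ->
  open (chart_image c `&` chart_inv c @^-1` O).
Proof.
move=> cc oO; rewrite openE => x [xi xO]; apply: filterI.
  exact: open_nbhs_nbhs (conj (chart_image_open cc) xi).
apply: (chart_inv_continuous cc xi).
exact: open_nbhs_nbhs (conj oO xO).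
Qed.

(** A closed coordinate ball is compact in the manifold; this gives compact
neighbourhoods, and in a Hausdorff manifold closed supports. *)
Lemma chart_ball (T : topologicalType) (c : chart R T m) (p : T) (U : set T) :
  is_chart c -> chart_dom c p -> nbhs p U ->
  exists e : R,
  let B := [set y | `|chart_fun c p - y| <= e] in
  [/\ 0 < e, B `<=` chart_image c, chart_inv c @` B `<=` U,
      compact (chart_inv c @` B) & nbhs p (chart_inv c @` B)].
Proof.
move=> cc pc pU; set x := chart_fun c p.
have xi : chart_image c x by exists p.
have : nbhs x (chart_image c `&` chart_inv c @^-1` U).
  apply: filterI; first exact: open_nbhs_nbhs (conj (chart_image_open cc) xi).
  by apply: (chart_inv_continuous cc xi); rewrite (chart_funK cc).
move=> /nbhs_ballP[e /= e0 He]; exists (e / 2).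
set B := [set y | `|x - y| <= e / 2].
have e20 : 0 < e / 2 by rewrite divr_gt0.
have BH y : B y -> chart_image c y /\ U (chart_inv c y).
  move=> By; apply: He; rewrite -ball_normE /ball_ /=.
  by rewrite (le_lt_trans By) // ltr_pdivrMr // mulr2n mulrDr mulr1 ltrDl.
split=> //.
- by move=> y /BH[].
- by move=> _ [y /BH[_ yU] <-].
- apply: continuous_compact.
    apply: continuous_in_subspaceT => y; rewrite inE => /BH[yi _].
    exact: chart_inv_continuous.
  apply: bounded_closed_compact; last exact: closed_closed_ball_.
  exists (`|x| + e / 2); split; first exact: num_real.
  move=> t tM y By; rewrite /= -[y](subKr x) (le_trans (ler_normB _ _)) //.
  by rewrite (le_trans _ (ltW tM)) // lerD2l.
- have : \forall q \near p, `|x - chart_fun c q| < e / 2.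
    have cx : chart_fun c q @[q --> p] --> x := chart_fun_continuous cc pc.
    by move/cvgr_dist_lt : cx; exact.
  have := open_nbhs_nbhs (conj (chart_dom_open cc) pc).
  apply: filterS2 => q qc /ltW xq.
  by exists (chart_fun c q) => //; rewrite (chart_funK cc).
Qed.

Lemma compact_nbhd M (p : M) (U : set M) : nbhs p U ->
  exists K : set M, [/\ compact K, nbhs p K & K `<=` U].
Proof.
move=> pU; have [c ac pc] := mf_atlas_cover p.
have [e [_ _ KU Kc pK]] := chart_ball (mf_atlas_chart ac) pc pU.
by exists (chart_inv c @` [set y | `|chart_fun c p - y| <= e]).
Qed.

Lemma smooth_cst M (a : R) : smooth (fun _ : M => a).
Proof. by move=> c ac; exact: smooth_on_cst. Qed.

Lemma smoothD M (f h : M -> R) : smooth f -> smooth h ->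
  smooth (fun q => f q + h q).
Proof.
move=> sf sh c ac; have oc := chart_image_open (mf_atlas_chart ac).
exact: smooth_onD (sf c ac) (sh c ac).
Qed.

Lemma smoothM M (f h : M -> R) : smooth f -> smooth h ->
  smooth (fun q => f q * h q).
Proof.
move=> sf sh c ac; have oc := chart_image_open (mf_atlas_chart ac).
exact: smooth_onM (sf c ac) (sh c ac).
Qed.

(** The bump is flat(e^2 - |y - y0|^2) in a chart, with the Euclidean square norm,
and 0 outside the chart.  It vanishes off a closed coordinate ball K, which is
closed in the whole manifold by compactness; this gives smoothness at points
outside the chart domain. *)
Lemma bump M (p : M) (U : set M) : nbhs p U ->
  exists (b : M -> R) (K : set M),
  [/\ smooth b, b p = 1, closed K, K `<=` U & forall q, ~ K q -> b q = 0].
Proof.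
move=> pU; have [c ac pc] := mf_atlas_cover p.
have cc := mf_atlas_chart ac.
have [e [e0 Bi KU Kc pK]] := chart_ball cc pc pU.
set B := [set y | `|chart_fun c p - y| <= e] in Bi KU Kc pK.
set K := chart_inv c @` B in KU Kc pK.
have Kcl : closed K := compact_closed (@mf_hausdorff _ _ M) Kc.
pose h (q : M) :=
  e ^+ 2 - \sum_j (chart_fun c q ord0 j - chart_fun c p ord0 j) ^+ 2.
pose b0 q := if `[< chart_dom c q >] then flat 1 (h q) else 0.
have b0K q : ~ K q -> b0 q = 0.
  move=> qK; rewrite /b0; case: asboolP => // qc; rewrite /flat.
  case: ifPn => // hq; exfalso; apply: qK.
  exists (chart_fun c q); last exact: chart_funK.
  (* a point of small Euclidean norm lies in the sup-norm ball *)
  rewrite /B /= [leLHS]/Num.norm /= mx_normrE; apply/bigmax_leP.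
  split=> [|[i j] _ /=]; first exact: ltW.
  rewrite (ord1 i) -(ler_pXn2r (n := 2)) ?nnegrE ?(ltW e0) //.
  rewrite real_normK ?num_real // !mxE -[X in X ^+ 2]opprB sqrrN.
  move: hq; rewrite /h subr_gt0 => /ltW; apply/le_trans.
  by rewrite (bigD1 j) //= lerDl sumr_ge0 // => k _; exact: sqr_ge0.
have b0p : b0 p != 0.
  rewrite /b0 asboolT // /flat /h big1 => [|j _]; last by rewrite subrr expr0n.
  rewrite subr0 exprn_gt0 // hornerC mul1r gt_eqF //; exact: expR_gt0.
have sb0 : smooth b0.
  move=> c' ac'; have cc' := mf_atlas_chart ac'.
  apply: smooth_on_local => x xi; have [qd qx] := chart_invP cc' xi.
  have [qc|qc] := pselect (chart_dom c (chart_inv c' x)); last first.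
    exists (chart_image c' `&` chart_inv c' @^-1` ~` K), (cst 0); split.
    - by apply: chart_image_open_setI => //; exact: closed_openC.
    - split=> // -[y By yx]; apply: qc; rewrite -yx.
      by have [] := chart_invP cc (Bi _ By).
    - exact: smooth_on_cst.
    - by move=> y [_ yK]; exact: b0K.
  pose V := chart_image c' `&` chart_inv c' @^-1` (chart_dom c).
  have oV : open V by apply: chart_image_open_setI => //; exact: chart_dom_open.
  exists V, (flat 1 \o (h \o chart_inv c')); split=> //; last first.
    by move=> y [_ yc]; rewrite /= /b0 asboolT.
  apply: smooth_on_flat => //; apply: smooth_onD => //.
    exact: smooth_on_cst.
  pose d j (x : 'rV[R]_m) :=
    chart_fun c (chart_inv c' x) ord0 j - chart_fun c p ord0 j.
  have sd j : smooth_on V (d j).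
    apply: smooth_onD => //; last exact: smooth_on_cst.
    by rewrite /V -chart_image_setI //; exact: mf_atlas_compat.
  have sS : smooth_on V (cst (-1) * (fun x => \sum_j d j x * d j x)).
    apply: smooth_onM => //; first exact: smooth_on_cst.
    by apply: smooth_on_sum => // j; exact: smooth_onM.
  by congr smooth_on: sS; apply/funext => y; rewrite /= !fctE mulN1r.
exists (fun q => (b0 p)^-1 * b0 q), K; split=> //.
- by apply: smoothM => //; exact: smooth_cst.
- by rewrite mulVf.
- by move=> q /b0K ->; rewrite mulr0.
Qed.

End Bumps.

(** * Derivations and global sections *)

Section Tangents.
Variables (R : realType) (m : nat) (M : manifold R m).
Implicit Types (p : M) (u v : functional M R).

Lemma tangent0 p : tangent p (0 : functional M R).
Proof.
have z f : (0 : functional M R) f = 0 by [].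
by split=> *; rewrite !z ?mulr0 ?addr0.
Qed.

Lemma tangentP p (a : R) u v :
  tangent p u -> tangent p v -> tangent p (a *: u + v).
Proof.
have E f : (a *: u + v) f = a * u f + v f by [].
move=> [ul uL uj] [vl vL vj]; split.
- by move=> b f h sf sh; rewrite !E ul // vl //; ring.
- by move=> f h sf sh; rewrite !E uL // vL //; ring.
- by move=> f nf; rewrite E uj // vj // mulr0 addr0.
Qed.

Lemma tangentD p u v : tangent p u -> tangent p v -> tangent p (u + v).
Proof. by move=> tu tv; have := tangentP 1 tu tv; rewrite scale1r. Qed.

Lemma tangentZ p (a : R) u : tangent p u -> tangent p (a *: u).
Proof. by move=> tu; have := tangentP a tu (tangent0 p); rewrite addr0. Qed.

(** Multiply f by a bump b at p supported where f = 0 and apply Leibniz to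
f * b = 0.  If f is not smooth, u f is 0 by convention. *)
Lemma tangent_near0 p u (f : M -> R) :
  tangent p u -> (\forall q \near p, f q = 0) -> u f = 0.
Proof.
move=> [ul uL uj] f0; have [sf|nf] := pselect (smooth f); last exact: uj.
have [b [K [sb bp _ KU bK]]] := bump f0.
have u0 : u (fun=> 0) = 0.
  rewrite -[RHS](addNr (u (fun=> 0))) -mulN1r -ul; try exact: smooth_cst.
  by congr u; apply/funext => q; rewrite mulr0 addr0.
have := uL _ _ sf sb; rewrite (nbhs_singleton f0) bp mul0r mul1r add0r => <-.
rewrite -[RHS]u0; congr u; apply/funext => q.
have [/KU ->|/bK ->] := pselect (K q); by rewrite ?mul0r ?mulr0.
Qed.

Lemma vfield0 : vfield (fun _ : M => (0 : functional M R)).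
Proof. by split=> [p|f sf]; [exact: tangent0|exact: smooth_cst]. Qed.

Lemma vfieldP (b : M -> R) (X Y : M -> functional M R) :
  smooth b -> vfield X -> vfield Y -> vfield (fun q => b q *: X q + Y q).
Proof.
move=> sb [tX sX] [tY sY]; split=> [p|f sf]; first exact: tangentP.
by apply: smoothD; [apply: smoothM => //; exact: sX|exact: sY].
Qed.

Lemma vfieldZ (b : M -> R) (X : M -> functional M R) :
  smooth b -> vfield X -> vfield (fun q => b q *: X q).
Proof.
move=> sb vX; have := vfieldP sb vX vfield0.
by congr vfield; apply/funext => q; rewrite addr0.
Qed.

Lemma vfield_lincomb k (c : 'I_k -> R) (Z : 'I_k -> M -> functional M R) :
  (forall j, vfield (Z j)) -> vfield (fun q => \sum_j c j *: Z j q).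
Proof.
move=> vZ; elim: (index_enum _) => [|j s IH].
  have := vfield0; congr vfield; apply/funext => q; by rewrite big_nil.
have := vfieldP (@smooth_cst _ _ M (c j)) (vZ j) IH.
by congr vfield; apply/funext => q; rewrite big_cons.
Qed.

End Tangents.

Section Sections.
Variables (R : realType) (m k : nat) (M : manifold R m) (N : manifold R k).
Variables (i : M -> N) (r : nat) (E : M -> set (functional N R)).
Hypothesis bE : subbundle i r E.

Lemma subbundle0 p : E p 0.
Proof.
have [Z [_ /nbhs_singleton[-> _]]] := bE p.
by exists (fun=> 0); rewrite big1 // => j _; rewrite scale0r.
Qed.

Lemma subbundle_extend p u : E p u ->
  exists2 Z : N -> functional N R, vfield Z & Z (i p) = u.
Proof.
have [Z [vZ /nbhs_singleton[-> _]]] := bE p => -[c ->].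
by exists (fun q => \sum_j c j *: Z j q) => //; exact: vfield_lincomb.
Qed.

(** On a compact neighbourhood K of p where a frame exists, cut off by b \o i,
with b a bump at i p on N supported off i (K minus its interior); put 0 outside
K.  That image is compact, hence closed, and avoids i p by injectivity of i.
Near a frontier point of K the factor b \o i already vanishes, so the result is
globally defined and extends locally to N. *)
Lemma subbundle_section p u : continuous i -> injective i -> E p u ->
  exists2 X, section_of i E X & X p = u.
Proof.
move=> ic ii; have [Z [vZ nZ]] := bE p.
have [Ep _] := nbhs_singleton nZ; rewrite {1}Ep => -[c ->{u}].
pose W q := \sum_j c j *: Z j q.
have vW : vfield W by exact: vfield_lincomb.
have [K [Kc pK KU]] := compact_nbhd nZ.
have Kcl : closed K := compact_closed (@mf_hausdorff _ _ M) Kc.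
pose A := i @` (K `\` K°).
have Acl : closed A.
  apply: (compact_closed (@mf_hausdorff _ _ N)); apply: continuous_compact.
    exact: continuous_subspaceT.
  apply: subclosed_compact Kc _; last by move=> ? [].
  by apply: closedI => //; apply: open_closedC; exact: open_interior.
have Ap : ~ A (i p) by move=> [q [_ qK] /ii qp]; apply: qK; rewrite qp.
have nAp : nbhs (i p) (~` A).
  by apply: open_nbhs_nbhs; split=> //; exact: closed_openC.
have [b [L [sb bp Lcl LA bL]]] := bump nAp.
pose X q := if `[< K q >] then b (i q) *: W (i q) else 0.
have pK' := nbhs_singleton pK.
exists X; last by rewrite /X asboolT //= bp scale1r.
split=> q.
  rewrite /X; case: asboolP => qK; last exact: subbundle0.
  have [-> _] := KU _ qK; exists (fun j => b (i q) * c j).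
  by rewrite scaler_sumr; apply: eq_bigr => j _; rewrite scalerA.
have [qK|qK] := pselect (K q); last first.
  exists (fun=> 0); split; first exact: vfield0.
  have : nbhs q (~` K) by apply: open_nbhs_nbhs; split=> //; exact: closed_openC.
  by apply: filterS => q' nK; rewrite /X asboolF.
have [qKi|qKi] := pselect (K° q).
  exists (fun x => b x *: W x); split; first exact: vfieldZ.
  by apply: filterS qKi => q' qK'; rewrite /X asboolT.
exists (fun=> 0); split; first exact: vfield0.
have nL : nbhs (i q) (~` L).
  apply: open_nbhs_nbhs; split; first exact: closed_openC.
  by move=> /LA; apply; exists q.
have nLi : \forall q' \near q, ~ L (i q') by exact: ic q _ nL.
apply: filterS nLi => q' nLq'.
by rewrite /X bL // scale0r; case: ifP.
Qed.

End Sections.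

(** * The metric, the Levi-Civita connection and nu *)

Section MetricAlgebra.
Variables (R : realType) (n q : nat) (Mb : manifold R (2 * n + 1)).
Variable S : kenmotsu_statistical q Mb.
Implicit Types (x : Mb) (u v w : functional Mb R).
Local Notation g := (ks_g S).
Local Notation nu := (ks_nu S).
Local Notation phi := (ks_phi S).

Lemma tangent_nu x : tangent x (nu x).
Proof. by case: (ks_nu_vfield S) => + _; exact. Qed.

Lemma metricC x u v : tangent x u -> tangent x v -> g x u v = g x v u.
Proof. exact: (Defs.metric_sym (ks_metric S)). Qed.

Lemma metric0l x w : tangent x w -> g x 0 w = 0.
Proof.
move=> tw; have := metric_linear (ks_metric S) 1 (tangent0 x) (tangent0 x) tw.
rewrite scale1r addr0 mul1r => /eqP.
by rewrite eq_sym addrC -subr_eq0 addrK => /eqP.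
Qed.

Lemma metricDl x u v w : tangent x u -> tangent x v -> tangent x w ->
  g x (u + v) w = g x u w + g x v w.
Proof.
move=> tu tv tw; have := metric_linear (ks_metric S) 1 tu tv tw.
by rewrite scale1r mul1r.
Qed.

Lemma metricZl x (a : R) u w : tangent x u -> tangent x w ->
  g x (a *: u) w = a * g x u w.
Proof.
move=> tu tw; have := metric_linear (ks_metric S) a tu (tangent0 x) tw.
by rewrite metric0l // !addr0.
Qed.

Lemma metricDr x u v w : tangent x u -> tangent x v -> tangent x w ->
  g x w (u + v) = g x w u + g x w v.
Proof.
move=> tu tv tw; rewrite metricC ?metricDl ?(metricC tw) //; exact: tangentD.
Qed.

Lemma metricZr x (a : R) u w : tangent x u -> tangent x w ->
  g x w (a *: u) = a * g x w u.
Proof.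
move=> tu tw; rewrite metricC ?metricZl ?(metricC tw) //; exact: tangentZ.
Qed.

Lemma metric_suml x k (c : 'I_k -> R) (e : 'I_k -> functional Mb R) w :
  (forall j, tangent x (e j)) -> tangent x w -> (forall j, g x (e j) w = 0) ->
  g x (\sum_j c j *: e j) w = 0.
Proof.
move=> te tw ge.
suff [] : tangent x (\sum_j c j *: e j) /\ g x (\sum_j c j *: e j) w = 0 by [].
elim/big_ind: _ => [|u v [tu gu] [tv gv]|j _].
- by split; [exact: tangent0|exact: metric0l].
- by split; [exact: tangentD|rewrite metricDl // gu gv addr0].
- by split; [exact: tangentZ|rewrite metricZl // ge mulr0].
Qed.

Lemma phi0 x : phi x 0 = 0.
Proof.
have := ks_phi_linear S 1 (tangent0 x) (tangent0 x).
by rewrite !scale1r addr0 => /eqP; rewrite eq_sym addrC -subr_eq0 addrK => /eqP.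
Qed.

(** Average the duality relation with the one obtained by exchanging Y and Z. *)
Lemma levi_civita_metric X Y Z : vfield X -> vfield Y -> vfield Z -> forall x,
  X x (fun y => g y (Y y) (Z y))
  = g x (ks_lc S X Y x) (Z x) + g x (Y x) (ks_lc S X Z x).
Proof.
move=> vX vY vZ x.
have tnab V W : vfield V -> vfield W -> tangent x (ks_nabla S V W x).
  by move=> vV vW; have [t _] := connection_vfield (ks_connection S) vV vW.
have tdual V W : vfield V -> vfield W -> tangent x (ks_dual S V W x).
  by move=> vV vW; have [t _] := connection_vfield (ks_dual_connection S) vV vW.
have tY := vY.1 x; have tZ := vZ.1 x.
have e1 := ks_duality S vX vY vZ x; have e2 := ks_duality S vX vZ vY x.
have eE : (fun y => g y (Z y) (Y y)) = (fun y => g y (Y y) (Z y)).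
  by apply/funext => y; apply: metricC; [exact: vZ.1|exact: vY.1].
rewrite eE in e2; rewrite /ks_lc.
have ? := tnab _ _ vX vY; have ? := tnab _ _ vX vZ.
have ? := tdual _ _ vX vY; have ? := tdual _ _ vX vZ.
rewrite metricZl ?metricZr ?metricDl ?metricDr //; try exact: tangentD.
rewrite [g x (Z x) _]metricC // in e2.
rewrite [g x (ks_nabla S X Z x) _]metricC // in e2.
move: e1 e2; lra.
Qed.

(** The shape of nu: its derivative along X is - X up to a multiple of nu, which
is orthogonal to Y at x. *)
Lemma levi_civita_nu X Y : vfield X -> vfield Y -> forall x,
  g x (Y x) (nu x) = 0 ->
  g x (ks_lc S X Y x) (nu x)
  = X x (fun y => g y (Y y) (nu y)) + g x (X x) (Y x).
Proof.
move=> vX vY x gY; have vn := ks_nu_vfield S.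
rewrite (levi_civita_metric vX vY vn) ks_lc_nu //.
have tX := vX.1 x; have tY := vY.1 x; have tn := vn.1 x.
have gN : g x (Y x) (- X x) = - g x (X x) (Y x).
  by rewrite -scaleN1r metricZr // mulN1r (metricC tY tX).
rewrite metricDr // ?gN ?metricZr // ?gY.
- by rewrite mulr0 addr0 subrK.
- by rewrite -scaleN1r; exact: tangentZ.
- exact: tangentZ.
Qed.

End MetricAlgebra.

(** * Contact CR-lightlike submanifolds *)

Section ContactCR.
Variables (R : realType) (n q m r : nat) (Mb : manifold R (2 * n + 1)).
Variables (S : kenmotsu_statistical q Mb) (M : manifold R m) (i : M -> Mb).
Variables STM STperp ltr D0 D' L1 : M -> set (functional Mb R).
Hypothesis ccr : contact_CR_lightlike S i r STM STperp ltr D0 D' L1.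
Local Notation g := (ks_g S).
Local Notation nu := (ks_nu S).
Local Notation phi := (ks_phi S).
Implicit Types p : M.

Let ll := ccr_lightlike ccr.

Lemma subbundle_tangent k E p u : subbundle i k E -> E p u ->
  tangent (i p) u.
Proof. by move=> bE /(subbundle_extend bE)[Z [tZ _] <-]; exact: tZ. Qed.

Lemma rad_tangent p u : Rad S i p u -> tangent (i p) u.
Proof. exact: subbundle_tangent (ll_rad ll). Qed.

Lemma D0_tangent p u : D0 p u -> tangent (i p) u.
Proof. by have [k bE] := ccr_D0_bundle ccr; exact: subbundle_tangent bE. Qed.

Lemma D'_tangent p u : D' p u -> tangent (i p) u.
Proof. by have [k bE] := ccr_D'_bundle ccr; exact: subbundle_tangent bE. Qed.

Lemma phi_Rad0 p : phi_Rad S i p 0.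
Proof. by exists 0; [exact: subbundle0 (ll_rad ll) p|exact: phi0]. Qed.

Lemma D'0 p : D' p 0.
Proof. by have [k bE] := ccr_D'_bundle ccr; exact: subbundle0 bE p. Qed.

Lemma D00 p : D0 p 0.
Proof. by have [k bE] := ccr_D0_bundle ccr; exact: subbundle0 bE p. Qed.

Lemma STM_TM p u : STM p u -> TM i p u.
Proof.
move=> us; have [[-> _] _] := ll_screen ll p.
exists 0; first exact: subbundle0 (ll_rad ll) p.
by exists u; rewrite ?add0r.
Qed.

Lemma nu_STM p : STM p (nu (i p)).
Proof.
have [E [F [[EE _] [[FE _] _] [[-> _] _]]]] := ccr_screen ccr p.
exists 0; last by exists (nu (i p)); [exists 1; rewrite ?scale1r|rewrite add0r].
rewrite FE; exists 0; last by exists 0; [exact: D00|rewrite addr0].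
rewrite EE; exists 0; first exact: phi_Rad0.
by exists 0; [exact: D'0|rewrite addr0].
Qed.

Lemma D'_STM p u : D' p u -> STM p u.
Proof.
move=> uD; have [E [F [[EE _] [[FE _] _] [[-> _] _]]]] := ccr_screen ccr p.
exists u; last by exists 0; [exists 0; rewrite ?scale0r|rewrite addr0].
rewrite FE; exists u; last by exists 0; [exact: D00|rewrite addr0].
rewrite EE; exists 0; first exact: phi_Rad0.
by exists u; rewrite ?add0r.
Qed.

Lemma D'_nu p u : D' p u -> g (i p) u (nu (i p)) = 0.
Proof.
move=> uD; have [E [F [[EE _] [[FE _] _] [_ ort]]]] := ccr_screen ccr p.
apply: ort; last by exists 1; rewrite ?scale1r.
rewrite FE; exists u; last by exists 0; [exact: D00|rewrite addr0].
rewrite EE; exists 0; first exact: phi_Rad0.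
by exists u; rewrite ?add0r.
Qed.

Lemma D'_D0 p u v : D' p u -> D0 p v -> g (i p) u v = 0.
Proof.
move=> uD vD; have [E [F [[EE _] [_ ort] _]]] := ccr_screen ccr p.
apply: ort => //; rewrite EE; exists 0; first exact: phi_Rad0.
by exists u; rewrite ?add0r.
Qed.

Lemma TM_decomposition p w : TM i p w -> exists rho sigma d d0 (a : R),
  [/\ Rad S i p rho, Rad S i p sigma, D' p d, D0 p d0 &
      w = rho + (phi (i p) sigma + d + d0 + a *: nu (i p))].
Proof.
have [[-> _] _] := ll_screen ll p.
have [E [F [[EE _] [[FE _] _] [[-> _] _]]]] := ccr_screen ccr p.
move=> [rho rhoR [_ [f + [_ [a _ <-] <-]] <-]]; rewrite FE.
move=> [e + [d0 d0D <-]]; rewrite EE => -[_ [sigma sigmaR <-] [d dD <-]].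
by exists rho, sigma, d, d0, a.
Qed.

(** If D' were null at p, a vector u of D' with phi u in L1 would be orthogonal to
every summand of TM, hence in Rad and in the screen at once.  Against
phi(Rad) this uses skewness of phi and that L1 is normal to M. *)
Lemma D'_not_null p : exists u v, [/\ D' p u, D' p v & g (i p) u v != 0].
Proof.
apply: contrapT => null.
have gD u v : D' p u -> D' p v -> g (i p) u v = 0.
  by move=> uD vD; apply/eqP/negP => /negP guv; apply: null; exists u, v.
have [k k0 bL1] := ccr_L1_bundle ccr.
have [l lL1 l0] : exists2 l, L1 p l & l != 0.
  have [Z [_ /nbhs_singleton[-> free]]] := bL1 p.
  pose j0 := Ordinal k0; pose c j : R := (j == j0)%:R.
  exists (\sum_j c j *: Z j (i p)); first by exists c.
  by apply/eqP => /free /(_ j0) /eqP; rewrite /c eqxx oner_eq0.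
have [u uD ul] : (phi (i p) @` D' p) l.
  have [[-> _] _] := ccr_phi_D' ccr p; exists l => //.
  exists 0; last by rewrite addr0.
  have [xi [N [_ /nbhs_singleton[_ [-> _] _ _ _]]]] := ll_ltr ll p.
  by exists (fun=> 0); rewrite big1 // => j _; rewrite scale0r.
have tu := D'_tangent uD.
have lperp w : TM i p w -> g (i p) l w = 0.
  suff [_] : TMperp S i p l by apply.
  have [[-> _] _] := ll_transversal ll p.
  exists 0; first exact: subbundle0 (ll_rad ll) p.
  by exists l; [exact: (ccr_L1_sub ccr)|rewrite add0r].
have uRad : Rad S i p u.
  have uTM : TM i p u by apply: STM_TM; exact: D'_STM.
  split=> //; split=> // w /TM_decomposition[rho [sigma [d [d0 [a]]]]].
  move=> [rhoR sigmaR dD d0D ->].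
  have tr := rad_tangent rhoR; have ts := rad_tangent sigmaR.
  have td := D'_tangent dD; have td0 := D0_tangent d0D.
  have tps := ks_phi_tangent S ts; have tn := tangent_nu S (i p).
  have gur : g (i p) u rho = 0.
    by rewrite metricC //; have [_ [_]] := rhoR; exact.
  have gus : g (i p) u (phi (i p) sigma) = 0.
    have [k' bD'] := ccr_D'_bundle ccr.
    have [U vU Uu] := subbundle_extend bD' uD.
    have [V vV Vs] := subbundle_extend (ll_rad ll) sigmaR.
    have := ks_phi_skew S vU vV (i p).
    by rewrite Uu Vs ul lperp ?add0r //; have [] := sigmaR.
  have perpD x y : tangent (i p) x /\ g (i p) u x = 0 ->
      tangent (i p) y /\ g (i p) u y = 0 ->
      tangent (i p) (x + y) /\ g (i p) u (x + y) = 0.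
    move=> [tx gx] [ty gy]; split; first exact: tangentD.
    by rewrite metricDr // gx gy addr0.
  suff [] : tangent (i p) (rho + (phi (i p) sigma + d + d0 + a *: nu (i p))) /\
      g (i p) u (rho + (phi (i p) sigma + d + d0 + a *: nu (i p))) = 0 by [].
  apply: (perpD _ _) => //; apply: (perpD _ _).
    apply: (perpD _ _); last by split=> //; exact: D'_D0.
    by apply: (perpD _ _); split=> //; exact: gD.
  by split; [exact: tangentZ|rewrite metricZr // D'_nu // mulr0].
have u0 : u = 0.
  have [[_ RS] _] := ll_screen ll p.
  have : (Rad S i p `&` STM p) u by split=> //; exact: D'_STM.
  by rewrite RS.
by move: l0; rewrite -ul u0 phi0 eqxx.
Qed.

(** nu is in the screen, to which ltr(TM) is orthogonal, and in TM, to which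
S(TM^perp) is orthogonal. *)
Lemma transversal_nu p w :
  set_sum (ltr p) (STperp p) w -> tangent (i p) w /\ g (i p) w (nu (i p)) = 0.
Proof.
have tn := tangent_nu S (i p).
move=> [a aL [b bS <-]].
have [ta ga] : tangent (i p) a /\ g (i p) a (nu (i p)) = 0.
  have [xi [N [vN /nbhs_singleton[_ [LE _] Nort _ _]]]] := ll_ltr ll p.
  move: aL; rewrite LE => -[c ->].
  have tN j : tangent (i p) (N j (i p)) by have [_ [t _]] := vN j.
  split; first by have [+ _] := vfield_lincomb c (fun j => (vN j).2); apply.
  by apply: metric_suml => // j; apply: Nort; left; exact: nu_STM.
have [k bST] := ll_transversal_bundle ll.
have tb := subbundle_tangent bST bS.
split; first exact: tangentD.
rewrite metricDl // ga add0r.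
suff [_] : TMperp S i p b by apply; exact: ccr_nu ccr p.
have [[-> _] _] := ll_transversal ll p.
exists 0; first exact: subbundle0 (ll_rad ll) p.
by exists b => //; rewrite add0r.
Qed.

(** A vector tangent to M differentiates along M only. *)
Lemma TM_derivative0 p u (f : Mb -> R) :
  TM i p u -> (\forall x \near p, f (i x) = 0) -> u f = 0.
Proof.
move=> [w tw <-] f0; rewrite /differential; case: ifP => // _.
exact: tangent_near0 tw f0.
Qed.

(** Of the three terms g(lc_X Y, nu), X(g(Y, nu)) and g(w, nu), with w the
transversal part, the last two vanish: this is where orthogonality of nu to D'
and to tr(TM) enters. *)
Lemma induced_derivative_nu X Y Z p :
  section_of i D' X -> section_of i D' Y ->
  induced_derivative S i STperp ltr X Y Z -> tangent (i p) (Z p) ->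
  g (i p) (Z p) (nu (i p)) = g (i p) (X p) (Y p).
Proof.
move=> [XD _] [YD _] /(_ p)[_ [w /transversal_nu[tw gw] lcZ]] tZ.
have [X' [Y' [[vX X'E] [vY Y'E] Zw]]] := lcZ.
have tn := tangent_nu S (i p).
rewrite -[LHS]addr0 -gw -metricDl // Zw.
rewrite levi_civita_nu //; last first.
  by rewrite -(nbhs_singleton Y'E); exact: D'_nu.
rewrite -(nbhs_singleton X'E) -(nbhs_singleton Y'E).
rewrite (@TM_derivative0 p) ?add0r //.
  by apply: STM_TM; exact: D'_STM.
by apply: filterS Y'E => x <-; exact: D'_nu.
Qed.

End ContactCR.

Theorem theorem4p5 (R : realType) (n q m r : nat)
    (Mb : manifold R (2 * n + 1)) (S : kenmotsu_statistical q Mb)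
    (M : manifold R m) (i : M -> Mb)
    (STM STperp ltr D0 D' L1 : M -> set (functional Mb R)) :
  contact_CR_lightlike S i r STM STperp ltr D0 D' L1 ->
  ~ totally_geodesic_foliation S i STperp ltr D'.
Proof.
move=> ccr tg; have [p _] := mf_nonempty M.
have [u [v [uD vD]]] := D'_not_null ccr p.
have [[ic _] ii _] := ll_immersed (ccr_lightlike ccr).
have [k bD'] := ccr_D'_bundle ccr.
have [X sX <-] := subbundle_section bD' ic ii uD.
have [Y sY <-] := subbundle_section bD' ic ii vD.
have [Z XYZ [ZD _]] := tg X Y sX sY.
have tZ := D'_tangent ccr (ZD p).
by rewrite -(induced_derivative_nu ccr sX sY XYZ tZ) (D'_nu ccr (ZD p)) eqxx.
Qed.
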